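(* Let $G$ be an infinite group and let $\mu$ be a symmetric, finitely supported generating probability measure on $G$. Then the real vector space $H(G,\mu)$ of harmonic functions on $(G,\mu)$ is finite dimensional if and only if $G$ contains a finite-index subgroup isomorphic to $(\mathbb{Z},+)$.
   Context: A probability measure $\mu$ on a group $G$ is generating if the semigroup generated by its support $\operatorname{supp}\mu$ is $G$, and symmetric if $\mu(g)=\mu(g^{-1})$ for all $g\in G$. A function $f:G\to\mathbb{R}$ is harmonic with respect to $\mu$ if $f(x)=\sum_{s\in\operatorname{supp}\mu}\mu(s)f(xs)$ for every $x\in G$; $H(G,\mu)$ denotes the space of all such functions. *)

(* Defs.v *)
From Stdlib Require Import Reals List ZArith.
Open Scope R_scope.

Record Group := {
  carrier :> Type;
  gmul : carrier -> carrier -> carrier;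
  gone : carrier;
  ginv : carrier -> carrier;
  gmul_assoc : forall x y z, gmul x (gmul y z) = gmul (gmul x y) z;
  gmul_1l : forall x, gmul gone x = x;
  gmul_1r : forall x, gmul x gone = x;
  gmul_Vl : forall x, gmul (ginv x) x = gone;
  gmul_Vr : forall x, gmul x (ginv x) = gone
}.

Arguments gmul {g}.
Arguments gone {g}.
Arguments ginv {g}.

Definition infinite_group (G : Group) : Prop :=
  ~ (exists l : list G, forall g : G, In g l).

Definition fin_supp_prob (G : Group) (mu : G -> R) (S : list G) : Prop :=
  (forall g, 0 <= mu g) /\
  NoDup S /\
  (forall g, In g S <-> mu g <> 0) /\
  fold_right Rplus 0 (map mu S) = 1.

Definition symmetric_measure (G : Group) (mu : G -> R) : Prop :=
  forall g : G, mu g = mu (ginv g).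

Definition gprod (G : Group) (l : list G) : G :=
  fold_right (fun a b => gmul a b) gone l.

Definition generating (G : Group) (S : list G) : Prop :=
  forall g : G, exists l : list G,
    l <> nil /\ Forall (fun s => In s S) l /\ g = gprod G l.

Definition harmonic (G : Group) (mu : G -> R) (S : list G) (f : G -> R) : Prop :=
  forall x : G, f x = fold_right Rplus 0 (map (fun s => mu s * f (gmul x s)) S).

Definition harmonic_fin_dim (G : Group) (mu : G -> R) (S : list G) : Prop :=
  exists B : list (G -> R),
    Forall (harmonic G mu S) B /\
    forall f, harmonic G mu S f ->
      exists c : list R, length c = length B /\
        forall x, f x = fold_right Rplus 0
                          (map (fun p => fst p * snd p x) (combine c B)).

Definition is_subgroup (G : Group) (H : G -> Prop) : Prop :=
  H gone /\ (forall x y, H x -> H y -> H (gmul x y)) /\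
  (forall x, H x -> H (ginv x)).

Definition finite_index (G : Group) (H : G -> Prop) : Prop :=
  exists r : list G, forall g : G, exists a h, In a r /\ H h /\ g = gmul a h.

Definition iso_to_Z (G : Group) (H : G -> Prop) : Prop :=
  exists phi : Z -> G,
    (forall a b, phi (a + b)%Z = gmul (phi a) (phi b)) /\
    (forall a b, phi a = phi b -> a = b) /\
    (forall g, H g <-> exists z, phi z = g).

Definition has_fi_Z_subgroup (G : Group) : Prop :=
  exists H : G -> Prop, is_subgroup G H /\ finite_index G H /\ iso_to_Z G H.

(* Main.v *)
Require Import Defs.
From Stdlib Require Import Reals List ZArith.
From Stdlib Require Import Lra Lia Classical ClassicalEpsilon
  FunctionalExtensionality Cantor FinFun.
Import ListNotations.

(** Write [Lap f x = f x - sum_s mu(s) f(x s)]. On finitely supported functions [Lap] is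
    injective (maximum principle), and Hahn-Banach on the countable group [G] shows that a
    finitely supported function orthogonal to every harmonic function is [Lap u] for a finitely
    supported [u], and that there is a Green function [g] with [Lap g] the point mass at [1].

    If [G] is virtually cyclic, a harmonic function vanishing on the boundary of a window of the
    line vanishes inside; the boundaries have bounded size, which bounds the dimension.

    Conversely let the space [H] of harmonic functions have finite dimension. Then a function
    harmonic on a large ball agrees on a small ball with a unique element of [H]. Applied to [g]
    this yields a locally constant [H]-valued function away from [1], one of whose level sets [A]
    is infinite and coinfinite with finite boundary. The flux form [<Lap (1_X h), k>] on [H] is
    antisymmetric, and nondegenerate when [X] has finite boundary and both [X] and its complement
    are infinite; hence there are no three disjoint infinite sets with finite boundary. So [G]
    has two ends, some [t] maps [A] properly into itself, and the finite set [A \ tA] is a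
    fundamental domain for the infinite cyclic group generated by [t]. *)

(** * Finite sums and linear algebra of function spaces *)

Definition sumL {T : Type} (l : list T) (f : T -> R) : R :=
  fold_right Rplus 0 (map f l).

Lemma sumL_cons {T} (a : T) l f : sumL (a :: l) f = f a + sumL l f.
Proof. reflexivity. Qed.

Lemma sumL_app {T} (l l' : list T) f : sumL (l ++ l') f = sumL l f + sumL l' f.
Proof.
  induction l as [|a l IH]; simpl; rewrite ?sumL_cons, ?IH; [unfold sumL at 2; simpl|]; lra.
Qed.

Lemma sumL_ext {T} (l : list T) f g :
  (forall x, In x l -> f x = g x) -> sumL l f = sumL l g.
Proof.
  intros H; induction l as [|a l IH]; [reflexivity|].
  rewrite !sumL_cons, IH, H; simpl; auto.
  intros x Hx; apply H; simpl; auto.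
Qed.

Lemma sumL_lin {T} (l : list T) a f g :
  sumL l (fun x => a * f x + g x) = a * sumL l f + sumL l g.
Proof.
  induction l as [|b l IH]; [unfold sumL; simpl; lra|].
  rewrite !sumL_cons, IH; lra.
Qed.

Lemma sumL_scal {T} (l : list T) a f : sumL l (fun x => a * f x) = a * sumL l f.
Proof.
  induction l as [|b l IH]; [unfold sumL; simpl; lra|].
  rewrite !sumL_cons, IH; lra.
Qed.

Lemma sumL_plus {T} (l : list T) f g :
  sumL l (fun x => f x + g x) = sumL l f + sumL l g.
Proof.
  induction l as [|b l IH]; [unfold sumL; simpl; lra|].
  rewrite !sumL_cons, IH; lra.
Qed.

Lemma sumL_minus {T} (l : list T) f g :
  sumL l (fun x => f x - g x) = sumL l f - sumL l g.
Proof.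
  induction l as [|b l IH]; [unfold sumL; simpl; lra|].
  rewrite !sumL_cons, IH; lra.
Qed.

Lemma sumL_zero {T} (l : list T) f : (forall x, In x l -> f x = 0) -> sumL l f = 0.
Proof.
  intros H; induction l as [|a l IH]; [reflexivity|].
  rewrite sumL_cons, H, IH; simpl; auto; [lra|].
  intros x Hx; apply H; simpl; auto.
Qed.

Lemma sumL_map {T U} (h : T -> U) (l : list T) f :
  sumL (map h l) f = sumL l (fun x => f (h x)).
Proof. unfold sumL; rewrite map_map; reflexivity. Qed.

Lemma sumL_swap {T U} (l : list T) (m : list U) f :
  sumL l (fun x => sumL m (f x)) = sumL m (fun y => sumL l (fun x => f x y)).
Proof.
  induction l as [|a l IH].
  - symmetry; apply sumL_zero; reflexivity.
  - rewrite sumL_cons, IH, <- sumL_plus; apply sumL_ext; intros y _; now rewrite sumL_cons.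
Qed.

Definition lin {T : Type} (V : (T -> R) -> Prop) : Prop :=
  V (fun _ => 0) /\
  forall a v w, V v -> V w -> V (fun x => a * v x + w x).

Lemma lin_eq {T} (V : (T -> R) -> Prop) v w :
  V v -> (forall x, v x = w x) -> V w.
Proof. intros Hv E; replace w with v; auto; now apply functional_extensionality. Qed.

Lemma lin_sub {T} (V : (T -> R) -> Prop) a v w :
  lin V -> V v -> V w -> V (fun x => v x - a * w x).
Proof.
  intros [_ H] Hv Hw; apply (lin_eq V (fun x => (- a) * w x + v x)); auto.
  intros; ring.
Qed.

Lemma lin_scal {T} (V : (T -> R) -> Prop) a v :
  lin V -> V v -> V (fun x => a * v x).
Proof.
  intros [H0 H] Hv; apply (lin_eq V (fun x => a * v x + 0)); auto.
  intros; ring.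
Qed.

Fixpoint span {T : Type} (B : list (T -> R)) (v : T -> R) : Prop :=
  match B with
  | [] => forall x, v x = 0
  | b :: B => exists a, span B (fun x => v x - a * b x)
  end.

Lemma span_lin {T} (B : list (T -> R)) : lin (span B).
Proof.
  induction B as [|b B [IH0 IH]]; split; simpl.
  - reflexivity.
  - intros a v w Hv Hw x; rewrite Hv, Hw; ring.
  - exists 0; apply (lin_eq _ _ _ IH0); intros; ring.
  - intros a v w [s Hs] [t Ht]; exists (a * s + t).
    apply (lin_eq _ _ _ (IH a _ _ Hs Ht)); intros; simpl; ring.
Qed.

Lemma span_combine {T} (B : list (T -> R)) v :
  span B v <-> exists c : list R, length c = length B /\
    forall x, v x = sumL (combine c B) (fun p => fst p * snd p x).
Proof.
  revert v; induction B as [|b B IH]; intros v; simpl.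
  - split; [intros H; exists []; auto | intros (c & _ & H) x].
    rewrite H; now destruct c.
  - split.
    + intros [a H]; apply IH in H as (c & Hc & H).
      exists (a :: c); split; [simpl; auto|]; intros x; simpl.
      rewrite sumL_cons; simpl; rewrite <- H; ring.
    + intros ([|a c] & Hc & H); [discriminate|].
      exists a; apply IH; exists c; split; [simpl in Hc; lia|].
      intros x; rewrite H; simpl; rewrite sumL_cons; simpl; ring.
Qed.

Lemma span_head {T} (b : T -> R) B : span (b :: B) b.
Proof.
  exists 1; apply (lin_eq _ _ _ (proj1 (span_lin B))); intros; ring.
Qed.

Lemma span_tail {T} (b : T -> R) B v : span B v -> span (b :: B) v.
Proof. intros H; exists 0; apply (lin_eq _ _ _ H); intros; ring. Qed.

Lemma span_sub {T} (V : (T -> R) -> Prop) B v :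
  lin V -> Forall V B -> span B v -> V v.
Proof.
  intros HV; revert v; induction B as [|b B IH]; intros v HB H; simpl in H.
  - apply (lin_eq _ _ _ (proj1 HV)); intros; now rewrite H.
  - destruct H as [a H]; inversion HB; subst.
    apply (lin_eq V (fun x => a * b x + (v x - a * b x))); [|intros; ring].
    apply HV; auto.
Qed.

Definition fin_dim {T : Type} (V : (T -> R) -> Prop) : Prop :=
  exists B, Forall V B /\ forall v, V v -> span B v.

Definition vanish_at {T : Type} (V : (T -> R) -> Prop) (t : T) : (T -> R) -> Prop :=
  fun v => V v /\ v t = 0.

Lemma vanish_at_lin {T} (V : (T -> R) -> Prop) t : lin V -> lin (vanish_at V t).
Proof.
  intros [H0 H]; split; [split; auto|].
  intros a v w [Hv Hv'] [Hw Hw']; split; auto; rewrite Hv', Hw'; ring.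
Qed.

(* [flag V ys] says that evaluations at the points [ys] are linearly independent on [V]:
   each point cuts the subspace vanishing at the previous ones properly. *)
Fixpoint flag {T : Type} (V : (T -> R) -> Prop) (ys : list T) : Prop :=
  match ys with
  | [] => True
  | y :: ys => (exists v, V v /\ v y <> 0) /\ flag (vanish_at V y) ys
  end.

Lemma flag_ext {T} ys : forall (V W : (T -> R) -> Prop),
  (forall v, V v <-> W v) -> flag V ys -> flag W ys.
Proof.
  induction ys as [|y ys IH]; intros V W E; simpl; auto.
  intros [(v & Hv & Hy) H]; split; [exists v; split; auto; now apply E|].
  apply (IH (vanish_at V y)); auto; intros u; unfold vanish_at; rewrite E; tauto.
Qed.

(** Exchange argument: imposing [v t = 0] costs at most the first [y] whose evaluation is
    proportional to that at [t] on the current subspace; from there on the two subspaces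
    coincide. *)
Lemma flag_vanish_at {T} (t : T) ys : forall V, lin V -> flag V ys ->
  exists ys', (length ys <= S (length ys'))%nat /\ incl ys' ys /\ flag (vanish_at V t) ys'.
Proof.
  induction ys as [|y ys IH]; intros V HV; simpl.
  - intros _; exists []; repeat split; simpl; auto; apply incl_refl.
  - intros [(v & Hv & Hy) H].
    destruct (classic (exists u, V u /\ u t = 0 /\ u y <> 0)) as [(u & Hu & Ht & Huy)|N].
    + destruct (IH _ (vanish_at_lin _ y HV) H) as (ys' & L & I & F).
      exists (y :: ys'); simpl; repeat split; [lia| | |].
      * intros z [<-|Hz]; simpl; auto.
      * exists u; unfold vanish_at; auto.
      * revert F; apply flag_ext; unfold vanish_at; tauto.
    + exists ys; repeat split; auto; [intros z; simpl; auto|].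
      assert (K : forall u, V u -> u t = 0 -> u y = 0).
      { intros u Hu Ht; apply NNPP; intros Hne; apply N; eauto. }
      revert H; apply flag_ext; intros w; unfold vanish_at; split; intros [Hw Hz];
        split; auto.
      assert (vt : v t <> 0) by (intros E; apply Hy; auto).
      pose proof (K _ (lin_sub V (w t / v t) w v HV Hw Hv)) as K'; simpl in K'.
      rewrite Hz in K'.
      assert (E : 0 - w t / v t * v y = 0) by (apply K'; field; auto).
      assert (E' : w t * v y = 0).
      { replace (w t * v y) with (- v t * (0 - w t / v t * v y)) by (field; auto).
        rewrite E; ring. }
      apply Rmult_integral in E' as [E'|E']; [auto|contradiction].
Qed.

(** Each zero imposed at a point of [L] costs at most one point of the flag, and no point can
    survive them all. *)
Lemma flag_length_le {T} (L : list T) : forall V ys, lin V -> flag V ys ->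
  (forall v, V v -> (forall t, In t L -> v t = 0) -> forall y, In y ys -> v y = 0) ->
  (length ys <= length L)%nat.
Proof.
  induction L as [|t L IH]; intros V ys HV F D.
  - destruct ys as [|y ys]; simpl; auto.
    destruct F as [(v & Hv & Hy) _]; exfalso; apply Hy, D; simpl; auto; tauto.
  - destruct (flag_vanish_at t ys V HV F) as (ys' & Hl & I & F').
    simpl; apply (Nat.le_trans _ _ _ Hl), le_n_S, (IH _ _ (vanish_at_lin V t HV) F').
    intros v [Hv Ht] HL y Hy; apply D; auto.
    intros z [<-|Hz]; auto.
Qed.

(** Vanishing at a point has codimension at most one, so each cut leaves an infinite-dimensional
    subspace. *)
Lemma not_fin_dim_flag {T} m : forall (V : (T -> R) -> Prop), lin V -> ~ fin_dim V ->
  exists ys, length ys = m /\ flag V ys.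
Proof.
  induction m as [|m IH]; intros V HV N; [exists []; simpl; auto|].
  destruct (classic (exists v y, V v /\ v y <> 0)) as [(v & y & Hv & Hy)|Z].
  - destruct (IH (vanish_at V y) (vanish_at_lin V y HV)) as (ys & L & F).
    + intros (B & HB & SB); apply N; exists (v :: B); split.
      * constructor; auto; revert HB; apply Forall_impl; intros u [Hu _]; auto.
      * intros w Hw; exists (w y / v y); apply SB; split.
        -- now apply lin_sub.
        -- field; auto.
    + exists (y :: ys); simpl; split; [lia|]; eauto.
  - exfalso; apply N; exists []; split; auto.
    intros v Hv x; apply NNPP; intros Hx; apply Z; eauto.
Qed.

(** * Finitely supported functionals, given by lists of weighted points *)

Definition pairing {T : Type} (p : list (R * T)) (f : T -> R) : R :=
  sumL p (fun q => fst q * f (snd q)).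

Lemma pairing_lin {T} (p : list (R * T)) a f g :
  pairing p (fun x => a * f x + g x) = a * pairing p f + pairing p g.
Proof.
  unfold pairing; rewrite <- sumL_lin; apply sumL_ext; intros; ring.
Qed.

Definition scale {T : Type} (a : R) (p : list (R * T)) : list (R * T) :=
  map (fun q => (a * fst q, snd q)) p.

Lemma pairing_scale {T} a (p : list (R * T)) f : pairing (scale a p) f = a * pairing p f.
Proof.
  unfold pairing, scale; rewrite sumL_map, <- sumL_scal; apply sumL_ext; intros; simpl; ring.
Qed.

Lemma pairing_app {T} (p q : list (R * T)) f :
  pairing (p ++ q) f = pairing p f + pairing q f.
Proof. apply sumL_app. Qed.

Lemma pairing_cons {T} a (x : T) p f : pairing ((a, x) :: p) f = a * f x + pairing p f.
Proof. reflexivity. Qed.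

(** Induction on [B]: if some [q] kills the tail and is 1 at [v], it serves to correct both [w] and
    the functional separating it. *)
Lemma span_or_separated {T} (B : list (T -> R)) : forall w,
  span B w \/ exists p, (forall v, In v B -> pairing p v = 0) /\ pairing p w = 1.
Proof.
  induction B as [|v B IH]; intros w; simpl.
  - destruct (classic (forall x, w x = 0)) as [Z|N]; [left; auto|right].
    apply not_all_ex_not in N as [x Hx]; exists [(/ w x, x)]; split; [tauto|].
    unfold pairing, sumL; simpl; field; auto.
  - destruct (IH v) as [Hv|(q & Hq & Hqv)].
    + destruct (IH w) as [Hw|(p & Hp & Hpw)]; [left; now apply span_tail|right].
      exists p; split; auto; intros u [<-|Hu]; auto.
      apply (span_sub (fun u => pairing p u = 0) B v); auto.
      * split; [apply sumL_zero; intros; ring|].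
        intros a f g Hf Hg; rewrite pairing_lin, Hf, Hg; ring.
      * apply Forall_forall; auto.
    + destruct (IH (fun x => w x - pairing q w * v x)) as [Hw|(p & Hp & Hpw)];
        [left; eauto|right].
      exists (scale (- pairing p v) q ++ p); split.
      * intros u [<-|Hu]; rewrite pairing_app, pairing_scale.
        -- rewrite Hqv; ring.
        -- rewrite Hq, (Hp u) by auto; ring.
      * rewrite pairing_app, pairing_scale, <- Hpw.
        replace (pairing p (fun x => w x - pairing q w * v x))
          with (pairing p (fun x => (- pairing q w) * v x + w x)).
        -- rewrite pairing_lin; ring.
        -- apply sumL_ext; intros; ring.
Qed.

(* Hahn-Banach for finitely supported functionals on a countable set: the subspace [J] is
   enlarged greedily by the evaluations as long as it avoids [p]; at the end every evaluation
   is a multiple of [p] modulo the enlarged subspace. *)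
Lemma extend_functional {T} (e : nat -> T) (J : ((T -> R) -> R) -> Prop) (lp : list (R * T)) :
  (forall x, exists n, e n = x) -> lin J -> ~ J (pairing lp) ->
  exists f : T -> R, pairing lp f = 1 /\ forall l, J (pairing l) -> pairing l f = 0.
Proof.
  intros He HJ Hp.
  pose (add := fun (N : ((T -> R) -> R) -> Prop) x r => exists c, N (fun f => r f - c * f x)).
  assert (add_lin : forall N x, lin N -> lin (add N x)).
  { intros N x [H0 H]; split.
    - exists 0; apply (lin_eq _ _ _ H0); intros; ring.
    - intros a v w [c Hc] [d Hd]; exists (a * c + d).
      apply (lin_eq _ _ _ (H a _ _ Hc Hd)); intros; simpl; ring. }
  assert (add_sub : forall N x r, N r -> add N x r).
  { intros N x r H; exists 0; apply (lin_eq _ _ _ H); intros; ring. }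
  pose (F := fix F n := match n with
    | O => J
    | S n => fun r => F n r \/ (~ add (F n) (e n) (pairing lp) /\ add (F n) (e n) r)
    end).
  assert (F_lin : forall n, lin (F n)).
  { induction n as [|n IH]; [exact HJ|].
    pose proof (add_lin (F n) (e n) IH) as IH'.
    split; [left; apply IH|].
    intros a v w [Hv|[N Hv]] [Hw|[N' Hw]].
    - left; now apply IH.
    - right; split; auto; apply IH'; auto.
    - right; split; auto; apply IH'; auto.
    - right; split; auto; apply IH'; auto. }
  assert (F_p : forall n, ~ F n (pairing lp)).
  { induction n as [|n IH]; [exact Hp|]; intros [H|[H H']]; auto. }
  assert (F_mono : forall n k r, F n r -> F (n + k)%nat r).
  { intros n k r H; induction k as [|k IH]; [now rewrite Nat.add_0_r|].
    rewrite Nat.add_succ_r; left; auto. }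
  pose (N := fun r => exists n, F n r).
  assert (N_lin : lin N).
  { split; [exists O; apply HJ|].
    intros a v w [n Hv] [m Hw]; exists (n + m)%nat; apply F_lin; [now apply F_mono|].
    rewrite Nat.add_comm; now apply F_mono. }
  assert (N_p : ~ N (pairing lp)) by (intros [n H]; now apply (F_p n)).
  (* If adding the evaluation would capture [pairing lp], the latter is [c] times it modulo [F n],
     with [c <> 0]; if not, the evaluation was itself added and [t = 0] works. *)
  assert (step : forall x, exists t, N (fun f => f x - t * pairing lp f)).
  { intros x; destruct (He x) as [n <-].
    destruct (classic (add (F n) (e n) (pairing lp))) as [[c Hc]|Hn].
    - destruct (Req_dec c 0) as [->|Hc0].
      + exfalso; apply (F_p n), (lin_eq _ _ _ Hc); intros; ring.
      + exists (/ c); exists n.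
        apply (lin_eq _ _ _ (lin_scal _ (- / c) _ (F_lin n) Hc)); intros; field; auto.
    - exists 0, (S n); right; split; auto; exists 1.
      apply (lin_eq _ _ _ (proj1 (F_lin n))); intros; ring. }
  (* These scalars define [f]: modulo [N], every [pairing l] is its value at [f] times
     [pairing lp]. *)
  destruct (choice _ step) as [f Hf].
  assert (key : forall l, N (fun g => pairing l g - pairing l f * pairing lp g)).
  { induction l as [|[a x] l IH].
    - apply (lin_eq _ _ _ (proj1 N_lin)); intros; unfold pairing, sumL; simpl; ring.
    - apply (lin_eq _ _ _ (proj2 N_lin a _ _ (Hf x) IH)); intros g.
      rewrite !pairing_cons; ring. }
  assert (multiple : forall a, N (fun g => a * pairing lp g) -> a = 0).
  { intros a H; destruct (Req_dec a 0) as [|Ha]; auto; exfalso; apply N_p.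
    apply (lin_eq _ _ _ (lin_scal _ (/ a) _ N_lin H)); intros; field; auto. }
  exists f; split.
  - cut (1 - pairing lp f = 0); [lra|]; apply multiple.
    apply (lin_eq _ _ _ (key lp)); intros; ring.
  - intros l Hl; apply multiple.
    assert (Nl : N (pairing l)) by (exists O; exact Hl).
    apply (lin_eq _ _ _ (lin_sub N 1 _ _ N_lin Nl (key l))); intros; ring.
Qed.

Lemma interpolation {T} (B : list (T -> R)) :
  exists Y : list (T * (T -> R)),
    (forall q, In q Y -> span B (snd q)) /\
    forall h, span B h -> forall x, h x = sumL Y (fun q => h (fst q) * snd q x).
Proof.
  induction B as [|b B (Y & HY & IH)].
  - exists []; split; [simpl; tauto|intros h H x; apply H].
  - pose (P := fun (h : T -> R) x => sumL Y (fun q => h (fst q) * snd q x)).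
    assert (P_lin : forall a u v x, P (fun z => a * u z + v z) x = a * P u x + P v x).
    { intros; unfold P; rewrite <- sumL_lin; apply sumL_ext; intros; ring. }
    assert (P_span : forall h, span B (P h)).
    { intros h; unfold P; clear IH P P_lin; induction Y as [|q Y IHY].
      - apply (lin_eq _ _ _ (proj1 (span_lin B))); reflexivity.
      - apply (lin_eq _ (fun x => h (fst q) * snd q x + sumL Y (fun q => h (fst q) * snd q x))).
        + apply span_lin; [apply HY; simpl; auto|]; apply IHY; intros; apply HY; simpl; auto.
        + intros; now rewrite sumL_cons. }
    assert (P_id : forall h, span B h -> forall x, P h x = h x)
      by (intros; symmetry; now apply IH).
    assert (dec : forall h, span (b :: B) h -> exists a, forall x, h x - P h x = a * (b x - P b x)).
    { intros h [a H]; exists a; intros x.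
      pose proof (P_id _ H x) as E.
      replace (fun x => h x - a * b x) with (fun x => (- a) * b x + h x) in E
        by (apply functional_extensionality; intros; ring).
      rewrite P_lin in E; lra. }
    destruct (classic (forall x, b x - P b x = 0)) as [Z|N].
    + exists Y; split; [intros; now apply span_tail, HY|].
      intros h H x; destruct (dec h H) as [a Ha]; specialize (Ha x); rewrite Z in Ha.
      unfold P in Ha; lra.
    + apply not_all_ex_not in N as [y Hy].
      (* [c] is 1 at the new node [y]; subtracting multiples of it makes the old functions vanish
         there. *)
      pose (c := fun x => / (b y - P b y) * (b x - P b x)).
      assert (Hc : span (b :: B) c).
      { apply lin_scal; [apply span_lin|].
        apply (lin_eq _ (fun x => b x - 1 * P b x)); [|intros; ring].
        apply lin_sub; [apply span_lin|apply span_head|apply span_tail, P_span]. }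
      exists ((y, c) :: map (fun q => (fst q, fun x => snd q x - snd q y * c x)) Y); split.
      * intros q [<-|Hq]; [exact Hc|].
        apply in_map_iff in Hq as (q' & <- & Hq'); cbn [snd].
        apply lin_sub; [apply span_lin|now apply span_tail, HY|exact Hc].
      * intros h H x; destruct (dec h H) as [a Ha].
        rewrite sumL_cons, sumL_map; simpl.
        replace (sumL Y (fun q => h (fst q) * (snd q x - snd q y * c x)))
          with (P h x - c x * P h y).
        2:{ unfold P; rewrite <- sumL_scal, <- sumL_minus; apply sumL_ext; intros; ring. }
        pose proof (Ha x); pose proof (Ha y).
        assert (E : c x * (h y - P h y) = h x - P h x).
        { rewrite Ha, Ha; unfold c; field; auto. }
        lra.
Qed.

(** * The Laplacian of a random walk *)

Lemma gmul_cancel_l {G : Group} (x y z : G) : gmul x y = gmul x z -> y = z.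
Proof.
  intros E; rewrite <- (gmul_1l G y), <- (gmul_1l G z), <- (gmul_Vl G x), <- !gmul_assoc.
  now rewrite E.
Qed.

Lemma gmul_cancel_r {G : Group} (x y z : G) : gmul y x = gmul z x -> y = z.
Proof.
  intros E; rewrite <- (gmul_1r G y), <- (gmul_1r G z), <- (gmul_Vr G x), !gmul_assoc.
  now rewrite E.
Qed.

Lemma gmulK {G : Group} (x y : G) : gmul (ginv x) (gmul x y) = y.
Proof. now rewrite gmul_assoc, gmul_Vl, gmul_1l. Qed.

Lemma gmulVK {G : Group} (x y : G) : gmul x (gmul (ginv x) y) = y.
Proof. now rewrite gmul_assoc, gmul_Vr, gmul_1l. Qed.

Lemma gmulrK {G : Group} (x y : G) : gmul (gmul y x) (ginv x) = y.
Proof. now rewrite <- gmul_assoc, gmul_Vr, gmul_1r. Qed.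

Lemma gmulrVK {G : Group} (x y : G) : gmul (gmul y (ginv x)) x = y.
Proof. now rewrite <- gmul_assoc, gmul_Vl, gmul_1r. Qed.

Lemma ginvK {G : Group} (x : G) : ginv (ginv x) = x.
Proof. apply (gmul_cancel_l (ginv x)); now rewrite gmul_Vr, gmul_Vl. Qed.

Lemma ginvM {G : Group} (x y : G) : ginv (gmul x y) = gmul (ginv y) (ginv x).
Proof.
  apply (gmul_cancel_l (gmul x y)); rewrite gmul_Vr, <- gmul_assoc, gmulVK.
  now rewrite gmul_Vr.
Qed.

Definition delta {T : Type} (y x : T) : R :=
  if excluded_middle_informative (x = y) then 1 else 0.

Lemma delta_eq {T} (x : T) : delta x x = 1.
Proof. unfold delta; destruct excluded_middle_informative; tauto. Qed.

Lemma delta_neq {T} (x y : T) : x <> y -> delta y x = 0.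
Proof. unfold delta; destruct excluded_middle_informative; tauto. Qed.

Lemma delta_sym {T} (x y : T) : delta x y = delta y x.
Proof.
  destruct (classic (x = y)) as [->|N]; auto; rewrite !delta_neq; auto.
Qed.

Lemma sumL_delta {T} (l : list T) (f : T -> R) y :
  NoDup l -> In y l -> sumL l (fun x => f x * delta y x) = f y.
Proof.
  intros N; induction N as [|a l Ha N IH]; simpl; [tauto|].
  intros Hy; rewrite sumL_cons.
  destruct (classic (a = y)) as [->|Hay].
  - rewrite delta_eq, sumL_zero; [ring|].
    intros x Hx; rewrite delta_neq; [ring|congruence].
  - rewrite delta_neq, IH by (tauto || auto); ring.
Qed.

Lemma sumL_nonneg_eq0 {T} (l : list T) f :
  (forall x, In x l -> 0 <= f x) -> sumL l f = 0 -> forall x, In x l -> f x = 0.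
Proof.
  assert (P : forall l, (forall x, In x l -> 0 <= f x) -> 0 <= sumL l f).
  { clear l; induction l as [|a l IH]; intros H; [unfold sumL; simpl; lra|].
    rewrite sumL_cons; pose proof (H a (or_introl eq_refl)).
    enough (0 <= sumL l f) by lra; apply IH; intros; apply H; simpl; auto. }
  induction l as [|a l IH]; intros H E x Hx; [destruct Hx|].
  rewrite sumL_cons in E.
  pose proof (H a (or_introl eq_refl)).
  assert (H' : forall x, In x l -> 0 <= f x) by (intros; apply H; simpl; auto).
  pose proof (P l H').
  destruct Hx as [<-|Hx]; [lra|apply IH; auto; lra].
Qed.

Lemma list_argmax {T} (f : T -> R) (l : list T) x : In x l ->
  exists m, In m l /\ forall y, In y l -> f y <= f m.
Proof.
  revert x; induction l as [|a l IH]; intros x Hx; [destruct Hx|].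
  destruct l as [|b l].
  - exists a; split; simpl; auto; intros y [<-|[]]; lra.
  - destruct (IH b (or_introl eq_refl)) as (m & Hm & M).
    destruct (Rle_dec (f a) (f m)).
    + exists m; split; [right; auto|]; intros y [<-|Hy]; auto.
    + exists a; split; [left; auto|]; intros y [<-|Hy]; [lra|].
      specialize (M y Hy); lra.
Qed.

Section RandomWalk.

Context (G : Group) (mu : G -> R) (S : list G).
Context (Ginf : infinite_group G) (Gprob : fin_supp_prob G mu S).
Context (Gsym : symmetric_measure G mu) (Ggen : generating G S).

Notation "x ** y" := (@gmul G x y) (at level 40, left associativity).

Definition lap (f : G -> R) (x : G) : R := f x - sumL S (fun s => mu s * f (x ** s)).

Lemma harmonic_lap f : harmonic G mu S f <-> forall x, lap f x = 0.
Proof.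
  unfold harmonic, lap, sumL; split; intros H x; specialize (H x); lra.
Qed.

Lemma lap_lin a f g x : lap (fun y => a * f y + g y) x = a * lap f x + lap g x.
Proof.
  unfold lap.
  rewrite (sumL_ext _ _ (fun s => a * (mu s * f (x ** s)) + mu s * g (x ** s)))
    by (intros; ring).
  rewrite sumL_lin; ring.
Qed.

Lemma lap_sub f g x : lap (fun y => f y - g y) x = lap f x - lap g x.
Proof.
  replace (fun y => f y - g y) with (fun y => (-1) * g y + f y)
    by (apply functional_extensionality; intros; ring).
  rewrite lap_lin; ring.
Qed.

Lemma lap_translate z f x : lap (fun y => f (z ** y)) x = lap f (z ** x).
Proof. unfold lap; f_equal; apply sumL_ext; intros; now rewrite gmul_assoc. Qed.

Lemma mu_sum : sumL S mu = 1.
Proof. apply Gprob. Qed.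

Lemma lap_const c x : lap (fun _ => c) x = 0.
Proof.
  unfold lap; rewrite (sumL_ext _ _ (fun s => c * mu s)) by (intros; ring).
  rewrite sumL_scal, mu_sum; ring.
Qed.

Lemma harmonic_linear : lin (harmonic G mu S).
Proof.
  split.
  - apply harmonic_lap; intros; apply lap_const.
  - intros a v w Hv Hw; apply harmonic_lap; intros x; rewrite lap_lin.
    rewrite harmonic_lap in Hv, Hw; rewrite Hv, Hw; ring.
Qed.

Lemma supp_inv s : In s S -> In (ginv s) S.
Proof.
  destruct Gprob as (_ & _ & H & _); rewrite !H, <- Gsym; auto.
Qed.

(** Connectedness of the Cayley graph of the support. *)
Lemma invariant_set_trivial (A : G -> Prop) :
  (forall x s, In s S -> A x -> A (x ** s)) -> forall x y, A x -> A y.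
Proof.
  intros HA x y Hx; destruct (Ggen (ginv x ** y)) as (l & _ & Hl & E).
  replace y with (x ** gprod G l) by (now rewrite <- E, gmulVK).
  clear E y; revert x Hx; induction Hl as [|s l Hs _ IH]; intros x Hx; simpl.
  - now rewrite gmul_1r.
  - rewrite gmul_assoc; auto.
Qed.

(** The points of [W] where a positive maximum is attained are stable under steps of the walk, hence
    exhaust [G], although [W] is finite and [G] is not. *)
Lemma max_principle (f : G -> R) (W : list G) :
  (forall x, In x W -> 0 < f x ->
     lap f x = 0 /\ forall s, In s S -> In (x ** s) W \/ f (x ** s) <= 0) ->
  forall x, In x W -> f x <= 0.
Proof.
  intros H x Hx; destruct (Rle_dec (f x) 0) as [|Hpos]; auto; exfalso; apply Ginf.
  destruct (list_argmax f W x Hx) as (m & Hm & M).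
  assert (Hfm : 0 < f m) by (specialize (M x Hx); lra).
  exists W; intros g.
  cut (In g W /\ f g = f m); [tauto|].
  apply (invariant_set_trivial (fun g => In g W /\ f g = f m)) with m; auto.
  clear x Hx Hpos g; intros x s Hs [Hx Efx].
  destruct (H x Hx) as [L N]; [lra|].
  assert (B : forall s, In s S -> f (x ** s) <= f m).
  { intros t Ht; destruct (N t Ht); [auto|lra]. }
  assert (E : mu s * (f m - f (x ** s)) = 0).
  { apply (sumL_nonneg_eq0 S (fun s => mu s * (f m - f (x ** s)))); auto.
    - intros t Ht; apply Rmult_le_pos; [apply Gprob|]; specialize (B t Ht); lra.
    - rewrite (sumL_ext _ _ (fun s => f m * mu s - mu s * f (x ** s))) by (intros; ring).
      rewrite sumL_minus, sumL_scal, mu_sum; unfold lap in L; lra. }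
  assert (Hmu : mu s <> 0) by (now apply Gprob).
  assert (Efs : f (x ** s) = f m).
  { apply Rmult_integral in E as [E|E]; [contradiction|lra]. }
  split; auto; destruct (N s Hs); auto; lra.
Qed.

Lemma max_principle_eq0 (f : G -> R) (W : list G) :
  (forall x, In x W -> lap f x = 0) ->
  (forall x s, In x W -> In s S -> In (x ** s) W \/ f (x ** s) = 0) ->
  forall x, In x W -> f x = 0.
Proof.
  intros H N x Hx; apply Rle_antisym.
  - apply (max_principle f W); auto.
    intros y Hy _; split; auto; intros s Hs; destruct (N y s Hy Hs); auto; right; lra.
  - cut (0 - f x <= 0); [lra|].
    apply (max_principle (fun x => 0 - f x) W); auto.
    intros y Hy _; split.
    + rewrite (lap_sub (fun _ => 0) f), lap_const, H; auto; ring.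
    + intros s Hs; destruct (N y s Hy Hs); auto; right; lra.
Qed.

Lemma finsupp_harmonic_eq0 (f : G -> R) (L : list G) :
  (forall x, f x <> 0 -> In x L) -> (forall x, lap f x = 0) -> forall x, f x = 0.
Proof.
  intros HL H x; apply NNPP; intros N; apply N.
  apply (max_principle_eq0 f L); auto.
  intros y s _ _; destruct (classic (f (y ** s) = 0)); auto.
Qed.

Lemma sum_mu_delta y z : sumL S (fun s => mu s * delta z (y ** s)) = mu (ginv y ** z).
Proof.
  rewrite (sumL_ext _ _ (fun s => mu s * delta (ginv y ** z) s)).
  2:{ intros s _; f_equal; destruct (classic (y ** s = z)) as [<-|N].
      - now rewrite gmulK, !delta_eq.
      - rewrite !delta_neq; auto; intros ->; apply N, gmulVK. }
  destruct Gprob as (_ & ND & HS & _).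
  destruct (classic (In (ginv y ** z) S)) as [H|H]; [now apply sumL_delta|].
  rewrite sumL_zero.
  - symmetry; apply NNPP; rewrite <- HS; auto.
  - intros s Hs; rewrite delta_neq; [ring|congruence].
Qed.

Lemma mu_sym x y : mu (ginv x ** y) = mu (ginv y ** x).
Proof. now rewrite Gsym, ginvM, ginvK. Qed.

Lemma lap_delta_sym y z : lap (delta z) y = lap (delta y) z.
Proof. unfold lap; now rewrite !sum_mu_delta, mu_sym, delta_sym. Qed.

Definition coef (u : list (R * G)) (x : G) : R := pairing u (delta x).

Lemma coef_supp u x : coef u x <> 0 -> In x (map snd u).
Proof.
  intros H; apply NNPP; intros N; apply H; apply sumL_zero; intros q Hq.
  rewrite delta_neq; [ring|]; intros <-; apply N, in_map, Hq.
Qed.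

(** Self-adjointness of [lap], from the symmetry of [mu]: the functional sending [f] to
    [pairing u (lap f)] has density [lap (coef u)]. *)
Lemma lap_coef u y : lap (coef u) y = pairing u (lap (delta y)).
Proof.
  transitivity (pairing u (fun z => lap (delta z) y)).
  - unfold lap, coef, pairing.
    rewrite (sumL_ext S _ (fun s => sumL u (fun q => mu s * (fst q * delta (y ** s) (snd q)))))
      by (intros; now rewrite sumL_scal).
    rewrite sumL_swap, <- sumL_minus; apply sumL_ext; intros q _.
    rewrite Rmult_minus_distr_l, <- sumL_scal; f_equal; [now rewrite delta_sym|].
    apply sumL_ext; intros; rewrite delta_sym; ring.
  - apply sumL_ext; intros; now rewrite lap_delta_sym.
Qed.

Definition lap_form (x : G) : list (R * G) := (1, x) :: map (fun s => (- mu s, x ** s)) S.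

Lemma pairing_lap_form x f : pairing (lap_form x) f = lap f x.
Proof.
  unfold lap_form, lap; rewrite pairing_cons; unfold pairing; rewrite sumL_map; simpl.
  rewrite (sumL_ext _ _ (fun s => (-1) * (mu s * f (x ** s)))) by (intros; ring).
  rewrite sumL_scal; ring.
Qed.

Fixpoint words (n : nat) : list G :=
  match n with
  | O => [gone]
  | Datatypes.S n => flat_map (fun s => map (gmul s) (words n)) S
  end.

Lemma group_countable : exists e : nat -> G, forall x, exists n, e n = x.
Proof.
  exists (fun k => let (n, i) := Cantor.of_nat k in nth i (words n) gone).
  intros x; destruct (Ggen x) as (l & _ & Hl & ->).
  assert (H : In (gprod G l) (words (length l))).
  { induction Hl as [|s l Hs _ IH]; simpl; auto.
    apply in_flat_map; exists s; split; auto; now apply in_map. }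
  destruct (In_nth _ _ gone H) as (i & _ & Hi).
  exists (Cantor.to_nat (length l, i)); now rewrite Cantor.cancel_of_to.
Qed.

Lemma lap_image_lin (Q : G -> Prop) :
  lin (fun phi : (G -> R) -> R => exists u, Forall (fun q => Q (snd q)) u /\
         phi = fun f => pairing u (lap f)).
Proof.
  split.
  - exists []; split; auto.
  - intros a v w (p & Hp & ->) (q & Hq & ->); exists (scale a p ++ q); split.
    + apply Forall_app; split; auto; unfold scale; apply Forall_map.
      revert Hp; apply Forall_impl; auto.
    + apply functional_extensionality; intros f; now rewrite pairing_app, pairing_scale.
Qed.

(** By Hahn-Banach it suffices that the Laplacian at [gone] is no combination of those at other
    points. Such a combination [u] would make [delta gone - coef u] harmonic of finite support, yet
    1 at [gone]. *)
Lemma green_function_exists :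
  exists g, lap g gone = 1 /\ forall x, x <> gone -> lap g x = 0.
Proof.
  destruct group_countable as [e He].
  destruct (extend_functional e _ (lap_form gone) He (lap_image_lin (fun x => x <> gone)))
    as (g & G1 & G0).
  - intros (u & Hu & E).
    assert (E' : forall y, lap (delta y) gone = pairing u (lap (delta y))).
    { intros y; rewrite <- pairing_lap_form; exact (f_equal (fun F => F (delta y)) E). }
    pose (f := fun x => delta gone x - coef u x).
    assert (Hf : forall x, f x = 0).
    { apply (finsupp_harmonic_eq0 f (gone :: map snd u)).
      - intros x Hx; destruct (classic (x = gone)) as [->|N]; [left; auto|right].
        apply coef_supp; intros Z; apply Hx; unfold f; rewrite Z, delta_neq; auto; ring.
      - intros x; unfold f; rewrite lap_sub, lap_coef, lap_delta_sym, E'; ring. }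
    specialize (Hf gone); unfold f in Hf; rewrite delta_eq in Hf.
    replace (coef u gone) with 0 in Hf; [lra|].
    symmetry; apply sumL_zero; intros q Hq; rewrite Forall_forall in Hu.
    rewrite delta_neq; [ring|auto].
  - exists g; rewrite <- pairing_lap_form; split; auto.
    intros x Hx; rewrite <- pairing_lap_form; apply G0.
    exists [(1, x)]; split; [repeat constructor; auto|].
    apply functional_extensionality; intros f; rewrite pairing_lap_form.
    unfold pairing, sumL; simpl; ring.
Qed.

(** Otherwise some [g] kills all Laplacian functionals, hence is harmonic, and yet pairs to 1 with
    [p]. *)
Lemma annihilator_harmonic (p : list (R * G)) :
  (forall h, harmonic G mu S h -> pairing p h = 0) ->
  exists u, forall f, pairing p f = pairing u (lap f).
Proof.
  intros Hp; apply NNPP; intros N.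
  destruct group_countable as [e He].
  destruct (extend_functional e _ p He (lap_image_lin (fun _ => True))) as (g & G1 & G0).
  - intros (u & _ & E); apply N; exists u; intros f; exact (f_equal (fun F => F f) E).
  - rewrite Hp in G1; [lra|]; apply harmonic_lap; intros x.
    rewrite <- pairing_lap_form; apply G0; exists [(1, x)]; split; [repeat constructor|].
    apply functional_extensionality; intros f; rewrite pairing_lap_form.
    unfold pairing, sumL; simpl; ring.
Qed.

Lemma fin_dim_harmonic : fin_dim (harmonic G mu S) <-> harmonic_fin_dim G mu S.
Proof.
  split; intros (B & HB & H); exists B; split; auto; intros f Hf.
  - now apply span_combine, H.
  - now apply span_combine, H.
Qed.

(** * Virtually cyclic groups *)

Lemma bounded_coordinates (phi : Z -> G) (r : list G) :
  (forall g, exists a z, In a r /\ g = phi z ** a) ->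
  forall l, exists k : nat, forall x, In x l ->
    exists a z, In a r /\ x = phi z ** a /\ (Z.abs z <= Z.of_nat k)%Z.
Proof.
  intros H; induction l as [|x l [k IH]]; [exists O; simpl; tauto|].
  destruct (H x) as (a & z & Ha & E).
  exists (k + Z.abs_nat z)%nat; intros y [<-|Hy].
  - exists a, z; repeat split; auto; lia.
  - destruct (IH y Hy) as (b & t & Hb & Et & Ht); exists b, t; repeat split; auto; lia.
Qed.

Lemma flat_map_length_const {T U} (f : T -> list U) l m :
  (forall x, In x l -> length (f x) = m) -> length (flat_map f l) = (length l * m)%nat.
Proof.
  intros H; induction l as [|a l IH]; simpl; auto.
  rewrite length_app, H, IH; simpl; auto; intros; apply H; simpl; auto.
Qed.

(** A step of the walk changes the coordinate in [Z] by at most [k], so a window of any size is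
    screened off by [2 * k * length r] points. *)
Lemma virtually_Z_fin_dim : has_fi_Z_subgroup G -> fin_dim (harmonic G mu S).
Proof.
  intros (H & (_ & _ & Hinv) & (r0 & Hr0) & phi & Hphi & _ & Himg).
  (* Inversion moves the power of [phi] to the left of the representative, since steps act on the
     right. *)
  pose (r := map ginv r0).
  assert (Hr : forall g, exists a z, In a r /\ g = phi z ** a).
  { intros g; destruct (Hr0 (ginv g)) as (a & h & Ha & Hh & E).
    apply Hinv, Himg in Hh as [z Hz].
    exists (ginv a), z; split; [now apply in_map|].
    now rewrite Hz, <- ginvM, <- E, ginvK. }
  clearbody r.
  destruct (bounded_coordinates phi r Hr (flat_map (fun a => map (gmul a) S) r)) as [k Hk].
  pose (win := fun zs : list Z => flat_map (fun z => map (gmul (phi z)) r) zs).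
  assert (Hwin : forall zs x, In x (win zs) <-> exists z a, In z zs /\ In a r /\ x = phi z ** a).
  { intros zs x; unfold win; rewrite in_flat_map; split.
    - intros (z & Hz & Hx); apply in_map_iff in Hx as (a & <- & Ha); eauto.
    - intros (z & a & Hz & Ha & ->); exists z; split; auto; now apply in_map. }
  pose (inner := fun N : nat => map (fun i => (Z.of_nat i - Z.of_nat N)%Z) (seq 0 (2 * N + 1))).
  assert (Hinner : forall N z, (Z.abs z <= Z.of_nat N)%Z <-> In z (inner N)).
  { intros N z; unfold inner; rewrite in_map_iff; split.
    - intros Hz; exists (Z.to_nat (z + Z.of_nat N)); rewrite in_seq; lia.
    - intros (i & <- & Hi); rewrite in_seq in Hi; lia. }
  pose (outer := fun N : nat =>
    map (fun i => (Z.of_nat i + Z.of_nat N + 1)%Z) (seq 0 k) ++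
    map (fun i => (- (Z.of_nat i + Z.of_nat N + 1))%Z) (seq 0 k)).
  assert (Houter : forall N z, (Z.of_nat N < Z.abs z <= Z.of_nat (N + k))%Z -> In z (outer N)).
  { intros N z Hz; unfold outer; rewrite in_app_iff, !in_map_iff.
    destruct (Z_lt_ge_dec z 0); [right|left];
      exists (Z.to_nat (Z.abs z - Z.of_nat N - 1)); rewrite in_seq; lia. }
  apply NNPP; intros ND.
  (* One more evaluation than [win (outer N)] has entries. *)
  destruct (not_fin_dim_flag (2 * k * length r + 1) _ harmonic_linear ND) as (ys & Ly & F).
  destruct (bounded_coordinates phi r Hr ys) as [N HN].
  assert (L : (length ys <= length (win (outer N)))%nat).
  { apply (flag_length_le _ _ _ harmonic_linear F).
    intros h Hh Z y Hy; rewrite harmonic_lap in Hh.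
    apply (max_principle_eq0 h (win (inner N))); auto.
    - intros x s Hx Hs; apply Hwin in Hx as (z & a & Hz & Ha & ->).
      apply Hinner in Hz.
      destruct (Hk (a ** s)) as (b & t & Hb & E & Ht).
      { apply in_flat_map; exists a; split; auto; now apply in_map. }
      assert (E' : phi z ** a ** s = phi (z + t)%Z ** b)
        by (rewrite <- gmul_assoc, E, gmul_assoc, Hphi; auto).
      destruct (Z_le_gt_dec (Z.abs (z + t)) (Z.of_nat N)) as [I|O].
      + left; apply Hwin; exists (z + t)%Z, b; rewrite <- Hinner; auto.
      + right; apply Z, Hwin; exists (z + t)%Z, b; split; auto.
        apply Houter; lia.
    - destruct (HN y Hy) as (a & z & Ha & -> & Hz).
      apply Hwin; exists z, a; rewrite <- Hinner; auto. }
  unfold win in L; rewrite (flat_map_length_const _ _ (length r)) in L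
    by (intros; now rewrite length_map).
  unfold outer in L; rewrite length_app, !length_map, !length_seq in L; nia.
Qed.

(** * Sets with finite boundary *)

Definition fin {T : Type} (A : T -> Prop) : Prop := exists L : list T, forall x, A x -> In x L.

Lemma fin_sub {T} (A B : T -> Prop) : (forall x, A x -> B x) -> fin B -> fin A.
Proof. intros H [L HL]; exists L; auto. Qed.

Lemma fin_union {T} (A B : T -> Prop) : fin A -> fin B -> fin (fun x => A x \/ B x).
Proof.
  intros [L HL] [M HM]; exists (L ++ M); intros x [H|H]; apply in_or_app; auto.
Qed.

Lemma fin_list_union {T U} (l : list U) (A : U -> T -> Prop) :
  (forall y, In y l -> fin (A y)) -> fin (fun x => exists y, In y l /\ A y x).
Proof.
  induction l as [|a l IH]; intros H; [exists []; intros x (y & [] & _)|].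
  apply (fin_sub _ (fun x => A a x \/ exists y, In y l /\ A y x)).
  - intros x (y & [<-|Hy] & Hx); eauto.
  - apply fin_union; [apply H; simpl; auto|]; apply IH; intros; apply H; simpl; auto.
Qed.

Lemma fin_preimage {T U} (A : U -> Prop) (h : T -> U) (k : U -> T) :
  (forall x, k (h x) = x) -> fin A -> fin (fun x => A (h x)).
Proof.
  intros K [L HL]; exists (map k L); intros x Hx; rewrite <- (K x); apply in_map; auto.
Qed.

Lemma fin_mul_l (A : G -> Prop) g : fin A -> fin (fun x => A (g ** x)).
Proof. apply (fin_preimage A (gmul g) (gmul (ginv g))), gmulK. Qed.

Lemma fin_mul_r (A : G -> Prop) g : fin A -> fin (fun x => A (x ** g)).
Proof. apply (fin_preimage A (fun x => x ** g) (fun x => x ** ginv g)); intros; apply gmulrK. Qed.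

Lemma fin_mul_l_inv (A : G -> Prop) g : fin (fun x => A (g ** x)) -> fin A.
Proof.
  intros H; apply (fin_mul_l _ (ginv g)) in H; revert H; apply fin_sub.
  intros x; now rewrite gmulVK.
Qed.

Lemma exists_notin {T} (A B : T -> Prop) : ~ fin A -> fin B -> exists x, A x /\ ~ B x.
Proof.
  intros HA HB; apply NNPP; intros N; apply HA; revert HB; apply fin_sub.
  intros x Hx; apply NNPP; intros Hn; eauto.
Qed.

Lemma not_fin_group : ~ fin (fun _ : G => True).
Proof. intros [L HL]; apply Ginf; exists L; auto. Qed.

(** Both ends of each edge between [X] and its complement are included. *)
Definition bdry (X : G -> Prop) (x : G) : Prop :=
  exists s, In s S /\ ~ (X x <-> X (x ** s)).

Lemma bdry_right (X : G -> Prop) x s : In s S -> ~ (X x <-> X (x ** s)) -> bdry X (x ** s).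
Proof.
  intros Hs H; exists (ginv s); rewrite gmulrK; split; [now apply supp_inv|tauto].
Qed.

Definition fin_bdry (X : G -> Prop) : Prop := fin (bdry X).

Lemma fin_bdry_not X : fin_bdry X -> fin_bdry (fun x => ~ X x).
Proof. apply fin_sub; intros x (s & Hs & H); exists s; split; auto; tauto. Qed.

Lemma fin_bdry_and X Y : fin_bdry X -> fin_bdry Y -> fin_bdry (fun x => X x /\ Y x).
Proof.
  intros HX HY; refine (fin_sub _ _ _ (fin_union _ _ HX HY)).
  intros x (s & Hs & H).
  destruct (classic (X x <-> X (x ** s))); [right|left]; exists s; split; auto; tauto.
Qed.

Lemma fin_bdry_mul_l X g : fin_bdry X -> fin_bdry (fun x => X (g ** x)).
Proof.
  intros H; refine (fin_sub _ _ _ (fin_mul_l _ g H)).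
  intros x (s & Hs & E); exists s; rewrite <- gmul_assoc; auto.
Qed.

(** The path from [z] along a fixed word for [y] must cross the boundary, which confines [z] to
    finitely many translates of it. *)
Lemma fin_bdry_shift X y : fin_bdry X -> fin (fun z => ~ (X z <-> X (z ** y))).
Proof.
  intros HX; destruct (Ggen y) as (l & _ & Hl & ->).
  induction Hl as [|s l Hs _ IH]; simpl.
  - exists []; intros x H; apply H; now rewrite gmul_1r.
  - refine (fin_sub _ _ _ (fin_union _ _ HX (fin_mul_r _ s IH))).
    intros z H; rewrite gmul_assoc in H.
    destruct (classic (X z <-> X (z ** s))); [right; tauto|left; now exists s].
Qed.

Lemma fin_bdry_deep X (L K : list G) : fin_bdry X -> ~ fin X ->
  exists z, X z /\ forall y, In y K -> X (z ** y) /\ ~ In (z ** y) L.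
Proof.
  intros HX HI.
  destruct (exists_notin X (fun z => exists y, In y K /\
    (~ (X z <-> X (z ** y)) \/ In (z ** y) L)) HI) as (z & Hz & N).
  - apply fin_list_union; intros y _; apply fin_union; [now apply fin_bdry_shift|].
    apply (fin_mul_r (fun x => In x L)); exists L; auto.
  - exists z; split; auto; intros y Hy; split.
    + apply NNPP; intros Hn; apply N; exists y; split; auto; left; tauto.
    + intros Hn; apply N; eauto.
Qed.

Lemma bdry_cover (X Y : G -> Prop) : fin_bdry X -> fin_bdry Y ->
  exists L, NoDup L /\ (forall x, bdry X x -> In x L) /\ (forall x, bdry Y x -> In x L).
Proof.
  intros [L HL] [M HM].
  exists (nodup (fun x y => excluded_middle_informative (x = y)) (L ++ M)).
  split; [apply NoDup_nodup|]; split; intros x Hx; apply nodup_In, in_or_app; auto.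
Qed.

(** * Flux through the boundary of a set *)

(** Passing from steps to points exposes the kernel [mu (ginv x ** y)], symmetric in [x] and [y]. *)
Lemma sum_mu_list x (q : G -> R) L : NoDup L ->
  (forall s, In s S -> q (x ** s) <> 0 -> In (x ** s) L) ->
  sumL S (fun s => mu s * q (x ** s)) = sumL L (fun y => mu (ginv x ** y) * q y).
Proof.
  intros ND H.
  rewrite (sumL_ext S _ (fun s => sumL L (fun y => mu s * (q y * delta (x ** s) y)))).
  - rewrite sumL_swap; apply sumL_ext; intros y _.
    rewrite <- sum_mu_delta, Rmult_comm, <- sumL_scal.
    apply sumL_ext; intros s _; rewrite delta_sym; ring.
  - intros s Hs; rewrite sumL_scal; f_equal.
    destruct (classic (In (x ** s) L)) as [I|I]; [now rewrite sumL_delta|].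
    rewrite sumL_zero.
    + apply NNPP; intros N; apply I, H; auto.
    + intros y Hy; rewrite delta_neq; [ring|congruence].
Qed.

(** Conservation of mass: [lap d] has total sum 0 when [d] has finite support. *)
Lemma no_finsupp_green (d : G -> R) (L : list G) :
  (forall x, d x <> 0 -> In x L) -> lap d gone = 1 ->
  (forall x, x <> gone -> lap d x = 0) -> False.
Proof.
  intros HL H1 H0.
  (* [M] holds [gone], the support of [d] and its neighbours, so no mass escapes from sums over
     [M]. *)
  pose (M := nodup (fun x y => excluded_middle_informative (x = y))
               (gone :: L ++ flat_map (fun x => map (gmul x) S) L)).
  assert (ND : NoDup M) by apply NoDup_nodup.
  assert (HM : forall x, d x <> 0 -> In x M).
  { intros x Hx; apply nodup_In; right; apply in_or_app; auto. }
  assert (HM' : forall x s, d x <> 0 -> In s S -> In (x ** s) M).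
  { intros x s Hx Hs; apply nodup_In; right; apply in_or_app; right.
    apply in_flat_map; exists x; split; auto; now apply in_map. }
  assert (E1 : sumL M (lap d) = 1).
  { rewrite (sumL_ext _ _ (fun x => 1 * delta gone x)).
    - apply (sumL_delta M (fun _ => 1)); auto; apply nodup_In; simpl; auto.
    - intros x _; destruct (classic (x = gone)) as [->|N]; [rewrite delta_eq, H1; ring|].
      rewrite H0, delta_neq; auto; ring. }
  assert (E0 : sumL M (lap d) = 0); [|lra].
  unfold lap; rewrite sumL_minus.
  rewrite (sumL_ext M (fun x => sumL S (fun s => mu s * d (x ** s)))
    (fun x => sumL M (fun y => mu (ginv x ** y) * d y))).
  2:{ intros x _; apply sum_mu_list; auto. }
  rewrite sumL_swap, <- sumL_minus; apply sumL_zero; intros y Hy.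
  rewrite (sumL_ext M _ (fun x => d y * (mu (ginv y ** x) * 1)))
    by (intros; rewrite mu_sym; ring).
  rewrite sumL_scal.
  destruct (Req_dec (d y) 0) as [->|Hd]; [ring|].
  rewrite <- (sum_mu_list y (fun _ => 1)); auto.
  rewrite (sumL_ext _ _ mu) by (intros; ring); rewrite mu_sum; ring.
Qed.

Definition ind (X : G -> Prop) (x : G) : R :=
  if excluded_middle_informative (X x) then 1 else 0.

Lemma ind_in (X : G -> Prop) x : X x -> ind X x = 1.
Proof. unfold ind; destruct excluded_middle_informative; tauto. Qed.

Lemma ind_out (X : G -> Prop) x : ~ X x -> ind X x = 0.
Proof. unfold ind; destruct excluded_middle_informative; tauto. Qed.

Lemma ind_iff (X : G -> Prop) x y : (X x <-> X y) -> ind X x = ind X y.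
Proof.
  intros E; destruct (classic (X x)); [rewrite !ind_in|rewrite !ind_out]; tauto.
Qed.

Definition cut (X : G -> Prop) (h : G -> R) : G -> R := fun x => ind X x * h x.

Lemma lap_cut X h x : harmonic G mu S h ->
  lap (cut X h) x = sumL S (fun s => mu s * ((ind X x - ind X (x ** s)) * h (x ** s))).
Proof.
  intros Hh; unfold lap, cut.
  rewrite (Hh x) at 1; fold (sumL S (fun s => mu s * h (x ** s))).
  rewrite <- sumL_scal, <- sumL_minus; apply sumL_ext; intros; ring.
Qed.

Lemma lap_cut_supp X h x : harmonic G mu S h -> lap (cut X h) x <> 0 -> bdry X x.
Proof.
  intros Hh H; apply NNPP; intros N; apply H; rewrite lap_cut by auto.
  apply sumL_zero; intros s Hs.
  rewrite (ind_iff X x (x ** s)); [ring|].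
  apply NNPP; intros E; apply N; now exists s.
Qed.

(* The flux form [<Lap (1_X h), k>]; [L] is any duplicate-free list containing the boundary. *)
Definition flux (L : list G) (X : G -> Prop) (h k : G -> R) : R :=
  sumL L (fun x => lap (cut X h) x * k x).

(** The two fluxes add up to a double sum of the symmetric kernel [mu (ginv x ** y)] against the
    antisymmetric [psi]. *)
Lemma flux_antisym L X h k : NoDup L -> (forall x, bdry X x -> In x L) ->
  harmonic G mu S h -> harmonic G mu S k -> flux L X h k = - flux L X k h.
Proof.
  intros ND HL Hh Hk.
  enough (E : flux L X h k + flux L X k h = 0) by lra.
  pose (psi := fun x y => (ind X x - ind X y) * (h y * k x + h x * k y)).
  assert (E : flux L X h k + flux L X k h =
              sumL L (fun x => sumL L (fun y => mu (ginv x ** y) * psi x y))).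
  { unfold flux; rewrite <- sumL_plus; apply sumL_ext; intros x _.
    rewrite <- (sum_mu_list x (psi x)); auto.
    - rewrite !lap_cut, !(Rmult_comm (sumL _ _)), <- !sumL_scal, <- sumL_plus by auto.
      apply sumL_ext; intros; unfold psi; ring.
    - intros s Hs Hpsi; apply HL, bdry_right; auto.
      intros E; apply Hpsi; unfold psi; rewrite (ind_iff X x (x ** s)); auto; ring. }
  rewrite E.
  assert (E' : sumL L (fun x => sumL L (fun y => mu (ginv x ** y) * psi x y)) =
     - sumL L (fun x => sumL L (fun y => mu (ginv x ** y) * psi x y))); [|lra].
  rewrite sumL_swap at 1.
  transitivity (-1 * sumL L (fun x => sumL L (fun y => mu (ginv x ** y) * psi x y))); [|ring].
  rewrite <- sumL_scal.
  apply sumL_ext; intros y _; rewrite <- sumL_scal; apply sumL_ext; intros x _.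
  rewrite mu_sym; unfold psi; ring.
Qed.

Lemma cut_lin X a h h' :
  cut X (fun x => a * h x + h' x) = fun x => a * cut X h x + cut X h' x.
Proof. apply functional_extensionality; intros x; unfold cut; ring. Qed.

Lemma flux_lin_l L X a h h' k :
  flux L X (fun x => a * h x + h' x) k = a * flux L X h k + flux L X h' k.
Proof.
  unfold flux; rewrite <- sumL_lin, cut_lin; apply sumL_ext; intros; rewrite lap_lin; ring.
Qed.

(** By [annihilator_harmonic] and self-adjointness [lap f] equals some [lap (coef u)]; subtract
    [coef u]. *)
Lemma harmonic_modulo_fin f L : NoDup L -> (forall x, lap f x <> 0 -> In x L) ->
  (forall k, harmonic G mu S k -> sumL L (fun x => lap f x * k x) = 0) ->
  exists h, harmonic G mu S h /\ fin (fun x => h x <> f x).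
Proof.
  intros ND HL H.
  pose (p := map (fun x => (lap f x, x)) L).
  assert (Hp : forall k, pairing p k = sumL L (fun x => lap f x * k x))
    by (intros; unfold p, pairing; now rewrite sumL_map).
  destruct (annihilator_harmonic p) as [u Hu].
  { intros h Hh; rewrite Hp; auto. }
  exists (fun x => f x - coef u x); split.
  - apply harmonic_lap; intros y; rewrite lap_sub, lap_coef, <- Hu, Hp.
    destruct (classic (In y L)) as [I|N].
    + rewrite sumL_delta; auto; ring.
    + rewrite sumL_zero, (NNPP (lap f y = 0)); [ring|auto|].
      intros x Hx; rewrite delta_neq; [ring|congruence].
  - exists (map snd u); intros x Hx; apply coef_supp; lra.
Qed.

(** * Groups whose harmonic functions form a finite-dimensional space *)

Section FiniteDimensional.

Context (B : list (G -> R)) (HB : Forall (harmonic G mu S) B).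
Context (Bspan : forall h, harmonic G mu S h -> span B h).

Lemma harmonic_interpolation : exists Y : list (G * (G -> R)),
  (forall q, In q Y -> harmonic G mu S (snd q)) /\
  forall h, harmonic G mu S h -> forall x, h x = sumL Y (fun q => h (fst q) * snd q x).
Proof.
  destruct (interpolation B) as (Y & H1 & H2); exists Y; split; auto.
  intros q Hq; apply (span_sub _ B); auto; apply harmonic_linear.
Qed.

(** Left translation preserves harmonicity, so the interpolation nodes may be moved to any [z]. *)
Lemma harmonic_determined : exists F : list G, forall h z, harmonic G mu S h ->
  (forall y, In y F -> h (z ** y) = 0) -> forall x, h x = 0.
Proof.
  destruct harmonic_interpolation as (Y & _ & HY); exists (map fst Y).
  intros h z Hh Hz x; rewrite <- (gmulVK z x).
  rewrite (HY (fun y => h (z ** y))).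
  - apply sumL_zero; intros q Hq; rewrite Hz; [ring|now apply in_map].
  - apply harmonic_lap; intros y; rewrite lap_translate; now apply harmonic_lap.
Qed.

(** [X] contains a translate of the determining set that misses the finitely many points of [X]
    where [h] is nonzero. *)
Lemma harmonic_eq0 X h : fin_bdry X -> ~ fin X -> harmonic G mu S h ->
  fin (fun x => X x /\ h x <> 0) -> forall x, h x = 0.
Proof.
  intros HX HI Hh [L HL]; destruct harmonic_determined as [F HF].
  destruct (fin_bdry_deep X L F HX HI) as (z & _ & Hz).
  apply (HF h z); auto; intros y Hy; destruct (Hz y Hy) as [H1 H2].
  apply NNPP; intros N; apply H2, HL; auto.
Qed.

(* The flux form of [X2] is antisymmetric and nondegenerate, so the flux of the constant [1]
   through the boundary of [X1] is cancelled by that of some [h] through the boundary of [X2].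
   This glues [1] on [X1], [-h] on [X2] and [0] on [X3] to a harmonic function modulo a
   finitely supported one. *)
Lemma no_three_ends X1 X2 X3 :
  fin_bdry X1 -> fin_bdry X2 -> fin_bdry X3 -> ~ fin X1 -> ~ fin X2 -> ~ fin X3 ->
  (forall x, X1 x -> X2 x -> False) -> (forall x, X1 x -> X3 x -> False) ->
  (forall x, X2 x -> X3 x -> False) -> False.
Proof.
  intros B1 B2 B3 I1 I2 I3 D12 D13 D23.
  destruct (bdry_cover X1 X2 B1 B2) as (L & ND & HL1 & HL2).
  pose proof harmonic_linear as HL.
  pose (one := fun _ : G => 1).
  assert (H1 : harmonic G mu S one) by exact (proj2 (harmonic_lap one) (lap_const 1)).
  (* If [k] has no flux, [cut X2 k] agrees off a finite set with a harmonic [h], which vanishes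
     because of [X3]; then [k] vanishes because of [X2]. *)
  assert (nondeg : forall k, harmonic G mu S k ->
    (forall h, harmonic G mu S h -> flux L X2 h k = 0) -> forall x, k x = 0).
  { intros k Hk Z.
    destruct (harmonic_modulo_fin (cut X2 k) L) as (h & Hh & Fh); auto.
    - intros x Hx; apply HL2; now apply (lap_cut_supp X2 k).
    - intros h Hh; fold (flux L X2 k h); rewrite flux_antisym, Z; auto; ring.
    - assert (h0 : forall x, h x = 0).
      { apply (harmonic_eq0 X3); auto; revert Fh; apply fin_sub; intros x [Hx N] E.
        apply N; rewrite E; unfold cut; rewrite ind_out; [ring|eauto]. }
      apply (harmonic_eq0 X2); auto; revert Fh; apply fin_sub; intros x [Hx N] E.
      apply N; rewrite h0 in E; unfold cut in E; rewrite ind_in in E; auto; lra. }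
  (* Fluxes become functions on the space of harmonic functions, where [span_or_separated]
     applies. *)
  pose (T := {k : G -> R | harmonic G mu S k}).
  destruct (span_or_separated
    (map (fun b (t : T) => flux L X2 b (proj1_sig t)) B)
    (fun t : T => flux L X1 one (proj1_sig t))) as [Sp|(p & Hp & Hp1)].
  - assert (Hh : exists h, harmonic G mu S h /\
       forall t : T, flux L X1 one (proj1_sig t) = flux L X2 h (proj1_sig t)).
    { apply (span_sub (fun v : T -> R => exists h, harmonic G mu S h /\
         forall t : T, v t = flux L X2 h (proj1_sig t)) _ _) in Sp; auto.
      - split.
        + exists (fun _ => 0); split; [apply HL|]; intros t; unfold flux.
          symmetry; apply sumL_zero; intros x _.
          replace (cut X2 (fun _ => 0)) with (fun _ : G => 0)
            by (apply functional_extensionality; intros; unfold cut; ring).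
          rewrite lap_const; ring.
        + intros a v w (h & Hh & Ev) (k & Hk & Ew).
          exists (fun x => a * h x + k x); split; [now apply HL|].
          intros t; rewrite flux_lin_l, Ev, Ew; ring.
      - apply Forall_map; revert HB; apply Forall_impl; intros b Hb; eauto. }
    destruct Hh as (h & Hh & E).
    pose (f := fun x => (-1) * cut X2 h x + cut X1 one x).
    destruct (harmonic_modulo_fin f L) as (k & Hk & Fk); auto.
    + intros x Hx; apply NNPP; intros N; apply Hx; unfold f; rewrite lap_lin.
      rewrite (NNPP (lap (cut X2 h) x = 0)), (NNPP (lap (cut X1 one) x = 0)); [ring| |].
      * intros Hn; apply N, HL1; now apply (lap_cut_supp X1 one).
      * intros Hn; apply N, HL2; now apply (lap_cut_supp X2 h).
    + intros k Hk; pose proof (E (exist _ k Hk)) as Ek; simpl in Ek; unfold flux in Ek.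
      rewrite (sumL_ext _ _ (fun x => (-1) * (lap (cut X2 h) x * k x) + lap (cut X1 one) x * k x))
        by (intros; unfold f; rewrite lap_lin; ring).
      rewrite sumL_lin; lra.
    + assert (k0 : forall x, k x = 0).
      { apply (harmonic_eq0 X3); auto; revert Fk; apply fin_sub; intros x [Hx N] E'.
        apply N; rewrite E'; unfold f, cut; rewrite !ind_out; [ring|eauto|eauto]. }
      apply I1; revert Fk; apply fin_sub; intros x Hx E'; rewrite k0 in E'.
      unfold f, cut, one in E'; rewrite (ind_in X1), (ind_out X2) in E'; eauto; lra.
  (* The separating functional is the flux against one harmonic [K], which [nondeg] makes zero,
     against [Hp1]. *)
  - pose (K := fun x => pairing p (fun t : T => proj1_sig t x)).
    assert (HK : harmonic G mu S K).
    { unfold K; clear Hp Hp1; induction p as [|[a t] p IH].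
      - apply (lin_eq _ _ _ (proj1 HL)); reflexivity.
      - apply (lin_eq _ _ _ (proj2 HL a _ _ (proj2_sig t) IH)); reflexivity. }
    assert (FK : forall X h, flux L X h K = pairing p (fun t => flux L X h (proj1_sig t))).
    { intros X h; unfold flux, K, pairing.
      rewrite (sumL_ext p _ (fun q => sumL L (fun x =>
        fst q * (lap (cut X h) x * proj1_sig (snd q) x)))) by (intros; now rewrite sumL_scal).
      rewrite sumL_swap; apply sumL_ext; intros x _.
      rewrite <- sumL_scal; apply sumL_ext; intros; ring. }
    assert (K0 : forall x, K x = 0).
    { apply nondeg; auto; intros h Hh.
      apply (span_sub (fun h => flux L X2 h K = 0) B); auto.
      - split.
        + unfold flux; apply sumL_zero; intros x _.
          replace (cut X2 (fun _ => 0)) with (fun _ : G => 0)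
            by (apply functional_extensionality; intros; unfold cut; ring).
          rewrite lap_const; ring.
        + intros a u v Hu Hv; rewrite flux_lin_l, Hu, Hv; ring.
      - apply Forall_forall; intros b Hb; rewrite FK; apply Hp.
        apply in_map_iff; now exists b. }
    rewrite <- FK in Hp1; unfold flux in Hp1; rewrite sumL_zero in Hp1; [lra|].
    intros; rewrite K0; ring.
Qed.

(** For fixed [x] the interpolation error is a finitely supported functional killing harmonic
    functions, so it factors through [lap] by [annihilator_harmonic]. *)
Lemma interpolation_defect : exists (Y : list (G * (G -> R))) (u : G -> list (R * G)),
  (forall q, In q Y -> harmonic G mu S (snd q)) /\
  (forall f x, f x = sumL Y (fun q => f (fst q) * snd q x) + pairing (u x) (lap f)).
Proof.
  destruct harmonic_interpolation as (Y & HYh & HY); exists Y.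
  destruct (choice (fun x u => forall f,
    f x = sumL Y (fun q => f (fst q) * snd q x) + pairing u (lap f))) as [u Hu].
  - intros x.
    destruct (annihilator_harmonic ((1, x) :: map (fun q => (- snd q x, fst q)) Y)) as [u Hu].
    + intros h Hh; rewrite pairing_cons; unfold pairing; rewrite sumL_map; simpl.
      rewrite (HY h Hh x), Rmult_1_l, <- sumL_plus; apply sumL_zero; intros; ring.
    + exists u; intros f; rewrite <- Hu, pairing_cons; unfold pairing; rewrite sumL_map; simpl.
      rewrite (Rplus_comm (1 * f x)), <- Rplus_assoc, <- sumL_plus, sumL_zero; [ring|].
      intros; ring.
  - exists u; auto.
Qed.

(* Away from the identity the Green function [g] coincides near each point [z] with a unique
   harmonic function [h z], locally constant in [z]. One of its level sets is the desired set:
   were it cofinite, [g] would be harmonic up to a finitely supported function. *)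
Lemma exists_end : exists A, fin_bdry A /\ ~ fin A /\ ~ fin (fun x => ~ A x).
Proof.
  destruct green_function_exists as (g & g1 & g0).
  destruct interpolation_defect as (Y & u & HY & Hu).
  assert (det : forall h z, harmonic G mu S h ->
    (forall q, In q Y -> h (z ** fst q) = 0) -> forall x, h x = 0).
  { intros h z Hh Hz x; rewrite <- (gmulVK z x), (Hu (fun y => h (z ** y))).
    rewrite harmonic_lap in Hh; unfold pairing; rewrite (sumL_zero Y), sumL_zero; [ring| |].
    - intros q _; rewrite lap_translate, Hh; ring.
    - intros q Hq; rewrite Hz; auto; ring. }
  (* Where [h z] must match [g] around [z]: at the nodes, at those seen from a neighbour, and at [z]
     itself. *)
  pose (K := gone :: map fst Y ++ flat_map (fun s => map (fun q => s ** fst q) Y) S).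
  (* For [z] outside [Bd], the error terms at points of [K] never involve the Laplacian of [g] at
     [gone]. *)
  pose (Bd := gone :: map ginv (flat_map (fun x => map snd (u x)) K)).
  pose (h := fun z x => sumL Y (fun q => g (z ** fst q) * snd q (ginv z ** x))).
  assert (Hh : forall z, harmonic G mu S (h z)).
  { intros z; unfold h; clear - HY Gprob; induction Y as [|q Y IH].
    - apply (lin_eq _ _ _ (proj1 harmonic_linear)); reflexivity.
    - assert (Hq : harmonic G mu S (fun x => snd q (ginv z ** x))).
      { apply harmonic_lap; intros x; rewrite lap_translate; apply harmonic_lap, HY; simpl; auto. }
      assert (IH' : forall q, In q Y -> harmonic G mu S (snd q))
        by (intros; apply HY; simpl; auto).
      apply (lin_eq _ _ _ (proj2 harmonic_linear (g (z ** fst q)) _ _ Hq (IH IH'))).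
      reflexivity. }
  assert (hg : forall z x, ~ In z Bd -> In x K -> h z (z ** x) = g (z ** x)).
  { intros z x Hz Hx; rewrite (Hu (fun y => g (z ** y)) x); unfold h; rewrite gmulK.
    unfold pairing; rewrite (sumL_zero (u x)); [ring|].
    intros q Hq; rewrite lap_translate, g0; [ring|]; intros E; apply Hz; right.
    apply in_map_iff; exists (snd q); split.
    - apply (gmul_cancel_r (snd q)); now rewrite gmul_Vl.
    - apply in_flat_map; exists x; split; auto; now apply in_map. }
  assert (step : forall z s, In s S -> ~ In z Bd -> ~ In (z ** s) Bd ->
    forall x, h z x = h (z ** s) x).
  { intros z s Hs Hz Hzs x.
    cut (h z x - 1 * h (z ** s) x = 0); [lra|].
    apply (det (fun x => h z x - 1 * h (z ** s) x) (z ** s)).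
    - apply lin_sub; auto; apply harmonic_linear.
    - intros q Hq; rewrite (hg (z ** s)); auto.
      + rewrite <- gmul_assoc, hg; auto; [ring|].
        right; apply in_or_app; right; apply in_flat_map; exists s; split; auto.
        apply (in_map (fun q => s ** fst q)); auto.
      + right; apply in_or_app; left; now apply in_map. }
  pose (A := fun t z => ~ In z Bd /\ forall x, h z x = h t x).
  assert (bA : forall t, fin_bdry (A t)).
  { intros t; exists (Bd ++ flat_map (fun b => map (fun s => b ** ginv s) S) Bd).
    intros z (s & Hs & E); apply in_or_app.
    destruct (classic (In z Bd)) as [Iz|Nz]; [left; auto|right].
    apply in_flat_map; exists (z ** s); split.
    - apply NNPP; intros Nzs; apply E; unfold A.
      pose proof (step z s Hs Nz Nzs) as St; split; intros [_ H]; split; auto; intros x.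
      + now rewrite <- St.
      + now rewrite St.
    - apply in_map_iff; exists s; split; auto; apply gmulrK. }
  pose (T := flat_map (fun b => map (gmul b) S) Bd).
  (* A level set avoiding [T] would be stable under steps and reach [gone], which lies in [Bd]. *)
  assert (cover : forall z, ~ In z Bd -> exists t, In t T /\ A t z).
  { intros z Hz; apply NNPP; intros N.
    assert (C : A z gone); [|apply C; left; auto].
    apply (invariant_set_trivial (A z)) with z; [|split; auto].
    intros y s Hs [Hy Ey].
    assert (Hys : ~ In (y ** s) Bd).
    { intros I; apply N; exists y; split; [|split; auto].
      apply in_flat_map; exists (y ** s); split; auto.
      apply in_map_iff; exists (ginv s); split; [apply gmulrK|now apply supp_inv]. }
    split; auto; intros x; rewrite <- Ey; symmetry; now apply step. }
  assert (HA : exists t, ~ fin (A t)).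
  { apply NNPP; intros N; apply not_fin_group.
    apply (fin_sub _ (fun z => In z Bd \/ exists t, In t T /\ A t z)).
    - intros z _; destruct (classic (In z Bd)); auto.
    - apply fin_union; [exists Bd; auto|].
      apply fin_list_union; intros t _; apply NNPP; intros Hn; apply N; eauto. }
  destruct HA as [t Ht]; exists (A t); split; [auto|split; auto].
  intros [L HL].
  assert (lap_d : forall x, lap (fun x => g x - h t x) x = lap g x).
  { intros x; rewrite lap_sub; replace (lap (h t) x) with 0; [ring|].
    symmetry; now apply harmonic_lap. }
  apply (no_finsupp_green (fun x => g x - h t x) L).
  - intros x Hx; apply HL; intros [Hb E]; apply Hx.
    pose proof (hg x gone Hb (or_introl eq_refl)) as Eg; rewrite gmul_1r, E in Eg; lra.
  - now rewrite lap_d.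
  - intros x Hx; rewrite lap_d; auto.
Qed.

End FiniteDimensional.

(** * Two-ended groups *)

Section TwoEnded.

Context (A : G -> Prop) (HA : fin_bdry A) (Ainf : ~ fin A) (Acoinf : ~ fin (fun x => ~ A x)).
Context (no_three : forall X1 X2 X3,
  fin_bdry X1 -> fin_bdry X2 -> fin_bdry X3 -> ~ fin X1 -> ~ fin X2 -> ~ fin X3 ->
  (forall x, X1 x -> X2 x -> False) -> (forall x, X1 x -> X3 x -> False) ->
  (forall x, X2 x -> X3 x -> False) -> False).

(** The translate of the boundary by [g] lies wholly on the side of [A] where [g] is, and likewise
    for [ginv g]. Below, [A (ginv g ** x)] is membership of [x] in the translate of [A] by [g]. *)
Definition far (g : G) : Prop :=
  forall b, bdry A b ->
    (A (g ** b) <-> A g) /\ (A (ginv g ** b) <-> A (ginv g)).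

Lemma far_inv g : far g -> far (ginv g).
Proof. intros H b Hb; rewrite ginvK; destruct (H b Hb); auto. Qed.

Lemma not_far_fin : fin (fun g => ~ far g).
Proof.
  destruct HA as [L HL].
  assert (F : fin (fun g => exists b, In b L /\ ~ (A g <-> A (g ** b))))
    by (apply fin_list_union; intros b _; now apply fin_bdry_shift).
  pose proof (fin_preimage _ ginv ginv ginvK F) as F'.
  refine (fin_sub _ _ _ (fin_union _ _ F F')).
  intros g Hg; apply not_all_ex_not in Hg as [b Hb].
  apply imply_to_and in Hb as [Hb N]; apply HL in Hb.
  destruct (classic (A g <-> A (g ** b))); [right|left]; exists b; split; auto; tauto.
Qed.

(** An edge leaving the corner [U] would start on the boundary of [A] or of its translate, which
    [far] keeps away from [U]. So [U] is stable under steps; it misses [g], hence is empty. The four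
    cases tell which corner it is. *)
Lemma far_nested g : far g ->
  (forall x, A (ginv g ** x) -> A x) \/ (forall x, A x -> A (ginv g ** x)) \/
  (forall x, A x \/ A (ginv g ** x)) \/ (forall x, A x -> A (ginv g ** x) -> False).
Proof.
  intros Hg.
  pose (U := fun x => (A x <-> ~ A g) /\ (A (ginv g ** x) <-> ~ A (ginv g))).
  assert (N : forall x, ~ U x).
  { intros x Hx; cut (U g); [unfold U; tauto|].
    apply (invariant_set_trivial U) with x; auto; clear x Hx.
    intros x s Hs [H1 H2].
    destruct (classic (A x <-> A (x ** s))) as [E|E];
    destruct (classic (A (ginv g ** x) <-> A (ginv g ** x ** s))) as [E'|E'].
    - unfold U; rewrite gmul_assoc; tauto.
    - destruct (Hg (ginv g ** x)) as [C _]; [now exists s|].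
      rewrite gmulVK in C; tauto.
    - destruct (Hg x) as [_ C]; [now exists s|]; tauto.
    - destruct (Hg x) as [_ C]; [now exists s|]; tauto. }
  unfold U in N.
  destruct (classic (A g)); destruct (classic (A (ginv g))).
  - right; right; left; intros x; specialize (N x); tauto.
  - left; intros x; specialize (N x); tauto.
  - right; left; intros x; specialize (N x); tauto.
  - right; right; right; intros x; specialize (N x); tauto.
Qed.

(** The ends of an edge crossing the boundary are sent by [g] to the same side, whereas an invariant
    [A] would keep them apart; so [A] would have no boundary. *)
Lemma far_not_stabilizer g : far g -> ~ (forall x, A x <-> A (ginv g ** x)).
Proof.
  intros Hg E; apply Acoinf; exists []; intros y Hy; apply Hy.
  destruct (exists_notin A (fun _ => False) Ainf) as (x & Hx & _); [exists []; tauto|].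
  apply (invariant_set_trivial A) with x; auto; clear x Hx y Hy.
  intros x s Hs Hx; apply NNPP; intros N.
  assert (Ne : ~ (A x <-> A (x ** s))) by tauto.
  destruct (Hg x) as [C1 _]; [now exists s|].
  destruct (Hg (x ** s)) as [C2 _]; [now apply bdry_right|].
  pose proof (E (g ** x)) as E1; pose proof (E (g ** (x ** s))) as E2.
  rewrite gmulK in E1, E2; tauto.
Qed.

Definition shrinks (g : G) : Prop :=
  (forall x, A (ginv g ** x) -> A x) /\
  (exists x, A x /\ ~ A (ginv g ** x)) /\
  fin (fun x => A x /\ ~ A (ginv g ** x)).

(** An infinite difference would be a third end beside the complement of [A] and the translate. *)
Lemma far_subset_shrinks g : far g -> (forall x, A (ginv g ** x) -> A x) -> shrinks g.
Proof.
  intros Hg H; split; [auto|split].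
  - apply NNPP; intros N; apply (far_not_stabilizer g Hg); intros x; split; auto.
    intros Hx; apply NNPP; intros Hn; apply N; eauto.
  - apply NNPP; intros N.
    pose proof (fin_bdry_mul_l A (ginv g) HA) as HgA.
    apply (no_three (fun x => ~ A x) (fun x => A (ginv g ** x))
             (fun x => A x /\ ~ A (ginv g ** x))); auto.
    + now apply fin_bdry_not.
    + apply fin_bdry_and; auto; now apply (fin_bdry_not (fun x => A (ginv g ** x))).
    + intros F; apply fin_mul_l_inv in F; auto.
    + tauto.
    + tauto.
Qed.

(** Two of the four nestings make [g] or [ginv g] shrink [A]. If [A] and its translate cover [G], an
    infinite intersection would be a third end beside the two complements. *)
Lemma far_shrinks_or_flips g : far g ->
  (exists g, shrinks g) \/ fin (fun x => A x /\ A (ginv g ** x)).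
Proof.
  intros Hg; destruct (far_nested g Hg) as [H|[H|[H|H]]].
  - left; exists g; now apply far_subset_shrinks.
  - left; exists (ginv g); apply far_subset_shrinks; [now apply far_inv|].
    rewrite ginvK; intros x Hx; apply H in Hx; now rewrite gmulK in Hx.
  - right; apply NNPP; intros N.
    pose proof (fin_bdry_mul_l A (ginv g) HA) as HgA.
    apply (no_three (fun x => ~ A x) (fun x => ~ A (ginv g ** x))
             (fun x => A x /\ A (ginv g ** x))); auto; try tauto.
    + now apply fin_bdry_not.
    + now apply (fin_bdry_not (fun x => A (ginv g ** x))).
    + now apply fin_bdry_and.
    + intros F; apply (fin_mul_l_inv (fun x => ~ A x)) in F; auto.
    + intros x H1 H2; destruct (H x); auto.
  - right; exists []; intros x [H1 H2]; exfalso; eauto.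
Qed.

(* Two elements exchanging the two ends differ by one that preserves them. *)
Lemma exists_shrinking : exists g, shrinks g.
Proof.
  apply NNPP; intros N.
  assert (flip : forall g, far g -> fin (fun x => A x /\ A (ginv g ** x))).
  { intros g Hg; destruct (far_shrinks_or_flips g Hg); [contradiction|auto]. }
  destruct (exists_notin _ _ not_fin_group not_far_fin) as (g1 & _ & F1); apply NNPP in F1.
  (* With [g2] and [ginv g1 ** g2] both far, [A] and its translates by [g1] and [g2] are pairwise
     almost disjoint, giving three ends. *)
  destruct (exists_notin _ _ not_fin_group
    (fin_union _ _ not_far_fin (fin_mul_l _ (ginv g1) not_far_fin))) as (g2 & _ & F2).
  apply not_or_and in F2 as [F2 F12]; apply NNPP in F2; apply NNPP in F12.
  apply flip in F1, F2, F12.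
  rewrite ginvM, ginvK in F12; apply (fin_mul_l _ (ginv g1)) in F12.
  pose proof (fin_bdry_mul_l A (ginv g1) HA) as B1.
  pose proof (fin_bdry_mul_l A (ginv g2) HA) as B2.
  apply (no_three A (fun x => A (ginv g1 ** x) /\ ~ A x)
           (fun x => A (ginv g2 ** x) /\ ~ A x /\ ~ A (ginv g1 ** x))); auto; try tauto.
  - apply fin_bdry_and; auto; now apply fin_bdry_not.
  - repeat apply fin_bdry_and; auto; [now apply fin_bdry_not|].
    now apply (fin_bdry_not (fun x => A (ginv g1 ** x))).
  - intros F; apply Ainf, (fin_mul_l_inv A (ginv g1)).
    refine (fin_sub _ _ _ (fin_union _ _ F F1)); intros x Hx.
    destruct (classic (A x)); tauto.
  - intros F; apply Ainf, (fin_mul_l_inv A (ginv g2)).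
    refine (fin_sub _ _ _ (fin_union _ _ F (fin_union _ _ F2 F12))); intros x Hx.
    rewrite <- gmul_assoc, gmulVK.
    destruct (classic (A x)); destruct (classic (A (ginv g1 ** x))); tauto.
Qed.

Lemma injective_sequence_infinite {T} (psi : nat -> T) (L : list T) :
  (forall i j, psi i = psi j -> i = j) -> (forall i, In (psi i) L) -> False.
Proof.
  intros Hinj HL.
  assert (H : (length (map psi (seq 0 (Datatypes.S (length L)))) <= length L)%nat).
  { apply NoDup_incl_length.
    - apply FinFun.Injective_map_NoDup; [intros i j; apply Hinj|apply seq_NoDup].
    - intros x Hx; apply in_map_iff in Hx as (i & <- & _); auto. }
  rewrite length_map, length_seq in H; lia.
Qed.

(** If a neighbour of [x] drops out of [P], it stays out by monotonicity while [x] stays in, so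
    infinitely many [psi n ** x] are boundary points. *)
Lemma orbit_leaves (P : G -> Prop) (psi : nat -> G) : fin_bdry P ->
  (forall i j, psi i = psi j -> i = j) ->
  (forall x n, P (psi (Datatypes.S n) ** x) -> P (psi n ** x)) ->
  forall x y, (forall n, P (psi n ** x)) -> forall n, P (psi n ** y).
Proof.
  intros [L HL] Hinj Hmono x y.
  apply (invariant_set_trivial (fun x => forall n, P (psi n ** x))); clear x y.
  intros x s Hs Hx n; apply NNPP; intros N.
  assert (N' : forall i, ~ P (psi (i + n)%nat ** (x ** s))).
  { induction i as [|i IH]; auto. }
  apply (injective_sequence_infinite (fun i => psi (i + n)%nat ** x) L).
  - intros i j E; apply gmul_cancel_r, Hinj in E; lia.
  - intros i; apply HL; exists s; split; auto.
    specialize (N' i); rewrite gmul_assoc in N'; specialize (Hx (i + n)%nat); tauto.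
Qed.

(** * Integer powers and the infinite cyclic subgroup *)

Fixpoint gpow (g : G) (n : nat) : G :=
  match n with O => gone | Datatypes.S n => g ** gpow g n end.

Definition zpow (g : G) (z : Z) : G :=
  gpow g (Z.to_nat z) ** gpow (ginv g) (Z.to_nat (- z)).

Lemma zpow_succ g z : zpow g (Z.succ z) = g ** zpow g z.
Proof.
  unfold zpow; destruct (Z_lt_ge_dec z 0).
  - replace (Z.to_nat (Z.succ z)) with O by lia; replace (Z.to_nat z) with O by lia.
    replace (Z.to_nat (- z)) with (Datatypes.S (Z.to_nat (- Z.succ z))) by lia.
    simpl; now rewrite !gmul_1l, gmulVK.
  - replace (Z.to_nat (Z.succ z)) with (Datatypes.S (Z.to_nat z)) by lia.
    replace (Z.to_nat (- Z.succ z)) with O by lia; replace (Z.to_nat (- z)) with O by lia.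
    simpl; now rewrite !gmul_1r.
Qed.

Lemma zpow_pred g z : zpow g (Z.pred z) = ginv g ** zpow g z.
Proof. rewrite <- (Z.succ_pred z) at 2; now rewrite zpow_succ, gmulK. Qed.

Lemma zpow_0 g : zpow g 0 = gone.
Proof. apply gmul_1r. Qed.

Lemma zpow_add g a b : zpow g (a + b) = zpow g a ** zpow g b.
Proof.
  induction a as [|a IH|a IH] using Z.peano_ind.
  - now rewrite zpow_0, gmul_1l.
  - now rewrite Z.add_succ_l, !zpow_succ, IH, gmul_assoc.
  - now rewrite Z.add_pred_l, !zpow_pred, IH, gmul_assoc.
Qed.

Lemma zpow_opp g z : zpow g (- z) = ginv (zpow g z).
Proof.
  apply (gmul_cancel_l (zpow g z)); rewrite <- zpow_add, gmul_Vr, Z.add_opp_diag_r.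
  apply zpow_0.
Qed.

(* [A] minus its translate by a shrinking element [g] is a finite fundamental domain for [<g>]. *)
Lemma two_ended_virtually_Z : has_fi_Z_subgroup G.
Proof.
  destruct exists_shrinking as (g & Hsub & (x0 & Hx0 & Nx0) & [D HD]).
  assert (mono : forall (n : nat) z x, A (zpow g (z - Z.of_nat n) ** x) -> A (zpow g z ** x)).
  { induction n as [|n IH]; intros z x; [now rewrite Z.sub_0_r|].
    intros H; apply IH, Hsub; rewrite gmul_assoc, <- zpow_pred.
    revert H; replace (Z.pred (z - Z.of_nat n)) with (z - Z.of_nat (Datatypes.S n))%Z by lia; auto. }
  assert (lt_neq : forall a b, (a < b)%Z -> zpow g a <> zpow g b).
  { intros a b L E; apply Nx0.
    replace (ginv g) with (zpow g (-1)).
    2:{ change (-1)%Z with (Z.pred 0); now rewrite zpow_pred, zpow_0, gmul_1r. }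
    apply (mono (Z.to_nat (b - a - 1))).
    replace (-1 - Z.of_nat (Z.to_nat (b - a - 1)))%Z with (a + - b)%Z by lia.
    now rewrite zpow_add, zpow_opp, E, gmul_Vr, gmul_1l. }
  assert (inj : forall a b, zpow g a = zpow g b -> a = b).
  { intros a b E; destruct (Z.lt_trichotomy a b) as [L|[L|L]]; auto; exfalso.
    - now apply (lt_neq a b).
    - now apply (lt_neq b a). }
  assert (down : forall x, exists n : nat, ~ A (zpow g (- Z.of_nat n) ** x)).
  { intros x; apply NNPP; intros N; apply Nx0; rewrite <- (gmul_1l G (ginv g ** x0)).
    rewrite <- (zpow_0 g).
    apply (orbit_leaves A (fun n => zpow g (- Z.of_nat n)) HA) with (x := x) (n := O).
    - intros i j E; apply inj in E; lia.
    - intros y n H; apply (mono 1%nat).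
      revert H; replace (- Z.of_nat n - Z.of_nat 1)%Z with (- Z.of_nat (Datatypes.S n))%Z by lia; auto.
    - intros n; apply NNPP; intros Hn; apply N; eauto. }
  assert (up : forall x, exists n : nat, A (zpow g (Z.of_nat n) ** x)).
  { intros x; apply NNPP; intros N.
    enough (H : ~ A (zpow g (Z.of_nat 0) ** x0)) by (apply H; rewrite zpow_0, gmul_1l; auto).
    apply (orbit_leaves (fun y => ~ A y) (fun n => zpow g (Z.of_nat n))) with (x := x) (n := O).
    - now apply fin_bdry_not.
    - intros i j E; apply inj in E; lia.
    - intros y n H H'; apply H, (mono 1%nat).
      revert H'; replace (Z.of_nat (Datatypes.S n) - Z.of_nat 1)%Z with (Z.of_nat n) by lia; auto.
    - intros n Hn; apply N; eauto. }
  (* Going down from a power in [A] to one outside, the last point in [A] lies in [A] minus its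
     translate. *)
  assert (domain : forall x, exists z, In (zpow g z ** x) D).
  { intros x; destruct (up x) as [n Hn]; destruct (down x) as [m Hm].
    apply NNPP; intros N.
    assert (H : forall j : nat, A (zpow g (Z.of_nat n - Z.of_nat j) ** x)).
    { induction j as [|j IH]; [now rewrite Z.sub_0_r|].
      apply NNPP; intros Hj; apply N; exists (Z.of_nat n - Z.of_nat j)%Z.
      apply HD; split; auto; rewrite gmul_assoc, <- zpow_pred.
      replace (Z.pred (Z.of_nat n - Z.of_nat j)) with (Z.of_nat n - Z.of_nat (Datatypes.S j))%Z by lia.
      auto. }
    apply Hm; specialize (H (n + m)%nat); revert H.
    replace (Z.of_nat n - Z.of_nat (n + m))%Z with (- Z.of_nat m)%Z by lia; auto. }
  exists (fun x => exists z, zpow g z = x); split; [|split].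
  - split; [exists 0%Z; apply zpow_0|]; split.
    + intros x y [a <-] [b <-]; exists (a + b)%Z; apply zpow_add.
    + intros x [a <-]; exists (- a)%Z; apply zpow_opp.
  (* Inverting turns representatives of right cosets into the left ones of [finite_index]. *)
  - exists (map ginv D); intros x; destruct (domain (ginv x)) as [z Hz].
    exists (ginv (zpow g z ** ginv x)), (zpow g z); split; [now apply in_map|split; [eauto|]].
    now rewrite ginvM, ginvK, gmulrVK.
  - exists (zpow g); split; [apply zpow_add|split; [auto|tauto]].
Qed.

End TwoEnded.

End RandomWalk.

Theorem theorem1p1 (G : Group) (mu : G -> R) (S : list G) :
  infinite_group G ->
  fin_supp_prob G mu S ->
  symmetric_measure G mu ->
  generating G S ->
  (harmonic_fin_dim G mu S <-> has_fi_Z_subgroup G).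
Proof.
  intros Ginf Gprob Gsym Ggen; split.
  - intros FD; apply fin_dim_harmonic in FD as (B & HB & Bspan).
    destruct (exists_end G mu S Ginf Gprob Gsym Ggen B HB Bspan) as (A & HA & I & I').
    apply (two_ended_virtually_Z G mu S Ginf Gprob Gsym Ggen A HA I I').
    apply (no_three_ends G mu S Gprob Gsym Ggen B HB Bspan).
  - intros V; apply fin_dim_harmonic.
    now apply (virtually_Z_fin_dim G mu S Ginf Gprob Ggen).
Qed.
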